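(* For all $n\ge0$ and $m\ge1$ the following hold (inequalities between functions hold at every $x>0$). (i) $\Delta V^{[m]}_n\in\mathcal M$ and $f^{[m]}_n\in\mathcal M$; in particular both are nonnegative, nonincreasing and $1$-Lipschitz. (ii) $\Delta V^{[m+1]}_n(x)\le\Delta V^{[m]}_n(x)$ and $f^{[m+1]}_n(x)\le f^{[m]}_n(x)$. (iii) $\Delta V^{[m]}_n(x)\le\Delta V^{[m]}_{n+1}(x)$ and $f^{[m]}_n(x)\le f^{[m]}_{n+1}(x)$. (iv) $V^{[m]}_n$ is convex, nonincreasing and $\mu$-Lipschitz in $x$ with $\mu:=\min\{m,n+1\}$, and $V^{[m]}_n(x)$ is nondecreasing in $n$ and in $m$.
   Context: Let $r\ge0$, $\alpha:=(1+r)^{-1}$, and $\lambda>1$ with $\lambda^{-1}<1+r<\lambda$. Put $p:=\frac{(1+r)-\lambda^{-1}}{\lambda-\lambda^{-1}}$, $q:=1-p$ (both in $(0,1)$). Let $K>0$ and $g(x):=(K-x)^+$ for $x>0$. For a function $\varphi$ on $(0,\infty)$ let $(\mathcal A\varphi)(x):=\alpha[p\,\varphi(\lambda x)+q\,\varphi(\lambda^{-1}x)]$. Define functions on $(0,\infty)$ recursively by $V^{[0]}_n\equiv0$ ($n\ge0$), $V^{[m]}_0=g$ ($m\ge1$), and, for $n,m\ge1$, $$V^{[m]}_n(x)=\max\{g(x)+(\mathcal AV^{[m-1]}_{n-1})(x),\ (\mathcal AV^{[m]}_{n-1})(x)\}.$$ For $m\ge1$ put $\Delta V^{[m]}_n:=V^{[m]}_n-V^{[m-1]}_n$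 ($n\ge 0$), $f^{[m]}_n:=\mathcal A\,\Delta V^{[m]}_{n-1}$ ($n\ge1$) and $f^{[m]}_0:=0$. $\mathcal M$ is the class of functions $\varphi:(0,\infty)\to[0,\infty)$ that are nonincreasing and satisfy $|\varphi(x)-\varphi(y)|\le|x-y|$ for all $x,y>0$. *)

(* Defs.v *)
From mathcomp Require Import all_boot all_order all_algebra.
From mathcomp Require Import all_classical all_reals all_analysis.

Set Implicit Arguments.
Unset Strict Implicit.
Unset Printing Implicit Defensive.

Import Order.TTheory GRing.Theory Num.Theory.
Import numFieldNormedType.Exports.

Local Open Scope classical_set_scope.
Local Open Scope ring_scope.

(* A function on (0, +oo) is represented by a total function R -> R of which
   only the values at x > 0 matter: since lam > 0, the operator [opA] maps the
   restrictions to (0, +oo) to each other. *)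

Definition discount (R : realType) (r : R) : R := (1 + r)^-1.

Definition prob_up (R : realType) (r lam : R) : R :=
  ((1 + r) - lam^-1) / (lam - lam^-1).

Definition prob_down (R : realType) (r lam : R) : R := 1 - prob_up r lam.

Definition payoff (R : realType) (K : R) : R -> R :=
  fun x => Num.max (K - x) 0.

Definition opA (R : realType) (r lam : R) (phi : R -> R) : R -> R :=
  fun x => discount r *
    (prob_up r lam * phi (lam * x) + prob_down r lam * phi (lam^-1 * x)).

(* [V r lam K m n] is V^{[m]}_n: the superscript comes first. *)
Fixpoint V (R : realType) (r lam K : R) (m n : nat) {struct n} : R -> R :=
  match m, n with
  | 0, _ => fun=> 0
  | _.+1, 0 => payoff K
  | m'.+1, n'.+1 => fun x =>
      Num.max (payoff K x + opA r lam (V r lam K m' n') x)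
              (opA r lam (V r lam K m'.+1 n') x)
  end.

(* Meaningful for m >= 1 only. *)
Definition DeltaV (R : realType) (r lam K : R) (m n : nat) : R -> R :=
  fun x => V r lam K m n x - V r lam K m.-1 n x.

Definition f (R : realType) (r lam K : R) (m n : nat) : R -> R :=
  match n with
  | 0 => fun=> 0
  | n'.+1 => opA r lam (DeltaV r lam K m n')
  end.

Definition classM (R : realType) (phi : R -> R) : Prop :=
  [/\ forall x, 0 < x -> 0 <= phi x,
      {in `]0, +oo[ &, nonincreasing_fun phi}
    & forall x y, 0 < x -> 0 < y -> `|phi x - phi y| <= `|x - y|].

(* Main.v *)
(* Write D m n, f m n for DeltaV and f.  Since V^{[m]}_{n+1} is the sum of
   A V^{[m-1]}_n and max(g, f^{[m]}_{n+1}), telescoping in m gives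
     D 1 n = max(g, f 1 n),   D (m+1) n = min(f m n, max(g, f (m+1) n)),
   as soon as f (m+1) n <= f m n.  The operator A is monotone and, because the
   discounted price is a martingale (A fixes the identity function), it
   preserves the Lipschitz constant; hence the class M, which is stable under
   min, max and A, and both monotonicity properties propagate along n. *)
Require Import Defs.
From mathcomp Require Import all_boot all_order all_algebra.
From mathcomp Require Import all_classical all_reals all_analysis.
From mathcomp Require Import ring lra zify.

Set Implicit Arguments.
Unset Strict Implicit.

Import Order.TTheory GRing.Theory Num.Theory.
Import numFieldNormedType.Exports.

Local Open Scope classical_set_scope.
Local Open Scope ring_scope.

(** * Nonincreasing, Lipschitz and convex functions on the positive half-line *)

Section FunctionClasses.
Context {R : realType}.
Implicit Types (L x y : R) (phi psi : R -> R).

(* Nonincreasing and L-Lipschitz on (0, +oo), in a form that [lra] can use. *)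
Definition gentle L phi : Prop :=
  forall x y, 0 < x -> x <= y -> 0 <= phi x - phi y <= L * (y - x).

Definition nonneg_pos phi : Prop := forall x, 0 < x -> 0 <= phi x.

(** The weight is a plain real, convenient for [lra] and [ring]; [convex_pos_convex_function] passes
    to the library notion. *)
Definition convex_pos phi : Prop :=
  forall t x y, 0 <= t <= 1 -> 0 < x -> 0 < y ->
    phi (t * x + (1 - t) * y) <= t * phi x + (1 - t) * phi y.

Lemma gentle_max L phi psi : gentle L phi -> gentle L psi ->
  gentle L (fun x => Num.max (phi x) (psi x)).
Proof.
move=> hphi hpsi x y x0 xy; have := hphi x y x0 xy; have := hpsi x y x0 xy.
by case: (leP (phi x)); case: (leP (phi y)); lra.
Qed.

Lemma gentle_min L phi psi : gentle L phi -> gentle L psi ->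
  gentle L (fun x => Num.min (phi x) (psi x)).
Proof.
move=> hphi hpsi x y x0 xy; have := hphi x y x0 xy; have := hpsi x y x0 xy.
by case: (leP (phi x)); case: (leP (phi y)); lra.
Qed.

Lemma gentleD L M phi psi : gentle L phi -> gentle M psi ->
  gentle (L + M) (fun x => phi x + psi x).
Proof.
move=> hphi hpsi x y x0 xy; have := hphi x y x0 xy; have := hpsi x y x0 xy.
by rewrite mulrDl; lra.
Qed.

Lemma gentle_le L M phi : L <= M -> gentle L phi -> gentle M phi.
Proof.
move=> LM hphi x y x0 xy; have /andP[-> h] := hphi x y x0 xy.
by apply: (le_trans h); rewrite ler_wpM2r// subr_ge0.
Qed.

(** Agreement at positive points is all that the min-max formula for the increments provides. *)
Lemma eq_gentle L phi psi : (forall x, 0 < x -> phi x = psi x) ->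
  gentle L psi -> gentle L phi.
Proof.
move=> e h x y x0 xy.
by rewrite !e ?(lt_le_trans x0 xy)//; exact: h.
Qed.

Lemma gentle_nonincreasing L phi :
  gentle L phi -> {in `]0, +oo[ &, nonincreasing_fun phi}.
Proof.
move=> h x y; rewrite !in_itv/= !andbT => x0 y0 xy.
by have /andP[] := h _ _ x0 xy; rewrite subr_ge0.
Qed.

Lemma gentle_lipschitz L phi x y : gentle L phi -> 0 < x -> 0 < y ->
  `|phi x - phi y| <= L * `|x - y|.
Proof.
move=> h; wlog xy : x y / x <= y.
  move=> H x0 y0; case/orP: (le_total x y) => xy; first exact: H.
  by rewrite distrC (distrC x); exact: H.
move=> x0 y0; have /andP[h0 h1] := h _ _ x0 xy.
by rewrite ger0_norm// ler0_norm ?subr_le0// opprB.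
Qed.

Lemma gentle_classM phi : nonneg_pos phi -> gentle 1 phi -> classM phi.
Proof.
move=> h0 h; split => //; first exact: gentle_nonincreasing h.
by move=> x y x0 y0; rewrite -[leRHS]mul1r; exact: gentle_lipschitz.
Qed.

Lemma convex_pos_max phi psi : convex_pos phi -> convex_pos psi ->
  convex_pos (fun x => Num.max (phi x) (psi x)).
Proof.
move=> hphi hpsi t x y t01 x0 y0; have /andP[t0 t1] := t01.
have t1' : 0 <= 1 - t by rewrite subr_ge0.
rewrite ge_max; apply/andP; split.
- by apply: (le_trans (hphi t x y t01 x0 y0)); rewrite lerD// ler_wpM2l// le_max lexx.
- by apply: (le_trans (hpsi t x y t01 x0 y0)); rewrite lerD// ler_wpM2l// le_max lexx orbT.
Qed.

Lemma convex_posD phi psi : convex_pos phi -> convex_pos psi ->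
  convex_pos (fun x => phi x + psi x).
Proof.
move=> hphi hpsi t x y t01 x0 y0.
have := hphi t x y t01 x0 y0; have := hpsi t x y t01 x0 y0.
by rewrite !mulrDr; lra.
Qed.

Lemma convex_pos_convex_function phi : convex_pos phi ->
  convex_function (`]0, +oo[%classic : set R) phi.
Proof.
move=> h t x y; rewrite !inE/= !in_itv/= !andbT => x0 y0.
have := h t%:num x y; rewrite !convRE; apply => //.
by apply/andP; split.
Qed.

Lemma payoff_ge0 (K x : R) : 0 <= payoff K x.
Proof. by rewrite /payoff le_max lexx orbT. Qed.

Lemma gentle_payoff (K : R) : gentle 1 (payoff K).
Proof.
by rewrite /payoff; apply: gentle_max => x y _; rewrite mul1r; lra.
Qed.

Lemma convex_pos_payoff (K : R) : convex_pos (payoff K).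
Proof.
by rewrite /payoff; apply: convex_pos_max => t x y _ _ _; rewrite le_eqVlt;
  apply/orP; left; apply/eqP; ring.
Qed.

End FunctionClasses.

(** * The one-step discounted pricing operator *)

Section PricingOperator.
Context {R : realType}.
Context {r lam : R}.
Hypotheses (hr : 0 <= r) (hlam : 1 < lam).
Hypotheses (hlow : lam^-1 < 1 + r) (hup : 1 + r < lam).
Implicit Types (L x : R) (phi psi : R -> R).

Lemma opAB phi psi x : opA r lam (fun y => phi y - psi y) x =
  opA r lam phi x - opA r lam psi x.
Proof. by rewrite /opA; ring. Qed.

(** The weights absorb the discount: u = alpha p, v = alpha q. The choice of p makes p lam + q / lam
    equal to 1 + r, whence the martingale identity. *)
Lemma opA_weights : exists u v : R, [/\ 0 <= u, 0 <= v,
  u * lam + v * lam^-1 = 1 &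
  forall phi x, opA r lam phi x = u * phi (lam * x) + v * phi (lam^-1 * x)].
Proof.
move: hr hlam hlow hup => r_ge0 lam_gt1 low up.
have lam0 : 0 < lam by lra.
have r0 : 0 < 1 + r by lra.
have d0 : 0 < lam - lam^-1 by lra.
have a0 : 0 <= (1 + r)^-1 by rewrite invr_ge0 ltW.
(* The bound lam^-1 < 1 + r gives p >= 0; below, 1 + r < lam gives p <= 1. *)
have p0 : 0 <= prob_up r lam by apply: divr_ge0; lra.
have q0 : 0 <= prob_down r lam.
  by rewrite /prob_down subr_ge0 /prob_up ler_pdivrMr// mul1r; lra.
exists (discount r * prob_up r lam), (discount r * prob_down r lam).
split; [exact: mulr_ge0|exact: mulr_ge0| |].
  have E : prob_up r lam * (lam - lam^-1) = 1 + r - lam^-1.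
    by rewrite /prob_up divfK// gt_eqF.
  have -> : discount r * prob_up r lam * lam +
      discount r * prob_down r lam * lam^-1 =
      discount r * (prob_up r lam * (lam - lam^-1) + lam^-1).
    by rewrite /prob_down; ring.
  by rewrite E subrK mulVf// gt_eqF.
by move=> phi x; rewrite /opA; ring.
Qed.

Let lam_gt0 : 0 < lam. Proof. exact: lt_trans hlam. Qed.

Let up_gt0 x : 0 < x -> 0 < lam * x.
Proof. exact: mulr_gt0. Qed.

Let down_gt0 x : 0 < x -> 0 < lam^-1 * x.
Proof. by apply: mulr_gt0; rewrite invr_gt0. Qed.

Lemma opA_le phi psi : (forall x, 0 < x -> phi x <= psi x) ->
  forall x, 0 < x -> opA r lam phi x <= opA r lam psi x.
Proof.
move=> h x x0; have [u [v [u0 v0 _ E]]] := opA_weights.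
by rewrite !E lerD// ler_wpM2l// h// ?up_gt0 ?down_gt0.
Qed.

Lemma opA_nonneg phi : nonneg_pos phi -> nonneg_pos (opA r lam phi).
Proof.
move=> h x x0; have [u [v [u0 v0 _ ->]]] := opA_weights.
by rewrite addr_ge0// mulr_ge0// h// ?up_gt0 ?down_gt0.
Qed.

(** The two dilations turn the constant L into L lam and L / lam, whose combination with weights u
    and v is L again by the martingale identity. *)
Lemma opA_gentle L phi : gentle L phi -> gentle L (opA r lam phi).
Proof.
move=> h x y x0 xy; have [u [v [u0 v0 uv E]]] := opA_weights; rewrite !E.
have /andP[a1 a2] : 0 <= phi (lam * x) - phi (lam * y) <= L * (lam * y - lam * x).
  by apply: h; rewrite ?up_gt0// ler_pM2l.
have /andP[b1 b2] :
    0 <= phi (lam^-1 * x) - phi (lam^-1 * y) <= L * (lam^-1 * y - lam^-1 * x).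
  by apply: h; rewrite ?down_gt0// ler_pM2l// invr_gt0.
have -> : L * (y - x) = u * (L * (lam * y - lam * x)) +
    v * (L * (lam^-1 * y - lam^-1 * x)).
  by rewrite -[LHS]mul1r -uv; ring.
have := mulr_ge0 u0 a1; have := mulr_ge0 v0 b1.
have := ler_wpM2l u0 a2; have := ler_wpM2l v0 b2.
by rewrite !mulrBr; lra.
Qed.

Lemma opA_convex phi : convex_pos phi -> convex_pos (opA r lam phi).
Proof.
move=> h t x y t01 x0 y0; have [u [v [u0 v0 _ E]]] := opA_weights.
rewrite !E.
have := ler_wpM2l u0 (h t _ _ t01 (up_gt0 x0) (up_gt0 y0)).
have := ler_wpM2l v0 (h t _ _ t01 (down_gt0 x0) (down_gt0 y0)).
have dist c : c * (t * x + (1 - t) * y) = t * (c * x) + (1 - t) * (c * y).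
  by ring.
by rewrite !dist; lra.
Qed.

End PricingOperator.

(** * Values and their increments in the number of exercise rights *)

Section SwingOption.
Context {R : realType}.
Context {r lam K : R}.
Hypotheses (hr : 0 <= r) (hlam : 1 < lam).
Hypotheses (hlow : lam^-1 < 1 + r) (hup : 1 + r < lam).
Implicit Types (m n : nat) (x : R).

Local Notation V := (V r lam K).
Local Notation D := (DeltaV r lam K).
Local Notation f := (f r lam K).
Local Notation A := (opA r lam).

Lemma V0E n : V 0 n = fun=> 0.
Proof. by case: n. Qed.

(** By linearity, [A (V m.+1 n)] is [A (V m n)] plus [f m.+1 n.+1], so both arms of the max share
    the term [A (V m n)]. *)
Lemma V_recE m n x :
  V m.+1 n.+1 x = A (V m n) x + Num.max (payoff K x) (f m.+1 n.+1 x).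
Proof.
rewrite /= opAB /= addr_maxr; congr (Num.max _ _); ring.
Qed.

Lemma DeltaV1E n x : D 1 n x = Num.max (payoff K x) (f 1 n x).
Proof.
rewrite /DeltaV /= V0E subr0; case: n => [|n].
  by rewrite /= (max_idPl (payoff_ge0 K x)).
rewrite V_recE V0E /opA; ring.
Qed.

(** Let a, b be the values of [f] at m + 1, m + 2 and g the payoff. For n > 0 the increment is a +
    max(g, b) - max(g, a); when b <= a this is a if g >= a, and max(g, b) otherwise. For n = 0 both
    sides vanish. *)
Lemma DeltaVSE m n x : f m.+2 n x <= f m.+1 n x ->
  D m.+2 n x = Num.min (f m.+1 n x) (Num.max (payoff K x) (f m.+2 n x)).
Proof.
case: n => [_|n].
  by rewrite /DeltaV /= subrr (max_idPl (payoff_ge0 K x)) (min_idPl (payoff_ge0 K x)).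
rewrite /DeltaV !V_recE.
have -> : A (V m.+1 n) x = A (V m n) x + f m.+1 n.+1 x.
  by rewrite /= opAB /=; ring.
move: (f m.+1 n.+1 x) (f m.+2 n.+1 x) (A _ x) (payoff K x) => a b c g ba.
by case: (leP g b) => gb; case: (leP g a) => ga; rewrite ?(min_idPr ba); lra.
Qed.

(** Superscripts start at 1: [D 0 n] is zero by the truncated predecessor while [D 1 n] dominates
    the payoff, so the decrease in m cannot start at 0. *)
Definition monotone_class (F : nat -> R -> R) : Prop :=
  [/\ forall m, nonneg_pos (F m.+1), forall m, gentle 1 (F m.+1) &
      forall m x, 0 < x -> F m.+2 x <= F m.+1 x].

Lemma DeltaV_of_f n : monotone_class (f ^~ n) -> monotone_class (D ^~ n).
Proof.
move=> [f0 fg fm]; split.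
- case=> [|m] x x0; first by rewrite DeltaV1E le_max payoff_ge0.
  by rewrite DeltaVSE ?fm// le_min f0//= le_max payoff_ge0.
- case=> [|m].
    apply: (eq_gentle (fun x _ => DeltaV1E n x)).
    by apply: gentle_max; [exact: gentle_payoff|exact: fg].
  apply: (@eq_gentle _ _ _ (fun x =>
    Num.min (f m.+1 n x) (Num.max (payoff K x) (f m.+2 n x)))).
    by move=> x x0; apply: DeltaVSE; exact: fm.
  apply: gentle_min; first exact: fg.
  by apply: gentle_max; [exact: gentle_payoff|exact: fg].
(* [f] separates consecutive increments: D (k+1) n <= f k n <= D k n for k >= 1. *)
- case=> [|m] x x0; rewrite DeltaVSE ?fm//.
    by rewrite DeltaV1E ge_min le_max lexx !orbT.
  rewrite DeltaVSE ?fm// le_min !ge_min fm//=.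
  by rewrite le_max lexx !orbT.
Qed.

(** The induction alternates: [DeltaV_of_f] goes from [f] to [D] at the same n, then [A] goes from
    [D] at n to [f] at n + 1. *)
Lemma f_class n : monotone_class (f ^~ n).
Proof.
elim: n => [|n /DeltaV_of_f[D0 Dg Dm]].
  by split=> [m x x0|m x y x0 xy|m x x0] //=; rewrite subrr lexx mul1r subr_ge0.
split=> [m|m|m] /=; [exact: opA_nonneg|exact: opA_gentle|].
by apply: opA_le => //; exact: Dm.
Qed.

Lemma DeltaV_class n : monotone_class (D ^~ n).
Proof. exact/DeltaV_of_f/f_class. Qed.

(** The min-max formula is monotone in each [f]; all k are allowed because [D m.+2] involves both
    [f m.+1] and [f m.+2]. *)
Lemma DeltaV_nondecreasing_of_f m n x : 0 < x ->
  (forall k, f k.+1 n x <= f k.+1 n.+1 x) -> D m.+1 n x <= D m.+1 n.+1 x.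
Proof.
move=> x0 h; case: m => [|m]; first by rewrite !DeltaV1E le_max2.
have [_ _ fm] := f_class n; have [_ _ fm'] := f_class n.+1.
by rewrite !DeltaVSE ?fm ?fm'// le_min2// le_max2.
Qed.

Lemma f_nondecreasing n m x : 0 < x -> f m.+1 n x <= f m.+1 n.+1 x.
Proof.
(* Since [f] vanishes at n = 0, the base case is nonnegativity at n = 1. *)
elim: n m x => [|n IH] m x x0; first by have [f0 _ _] := f_class 1; exact: f0.
apply: opA_le => // y y0; apply: DeltaV_nondecreasing_of_f => // k.
exact: IH.
Qed.

Lemma DeltaV_nondecreasing n m x : 0 < x -> D m.+1 n x <= D m.+1 n.+1 x.
Proof.
by move=> x0; apply: DeltaV_nondecreasing_of_f => // k; exact: f_nondecreasing.
Qed.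

Lemma V_nondecreasing_m n x : 0 < x -> nondecreasing_seq (fun m => V m n x).
Proof.
move=> x0; apply/nondecreasing_seqP => m.
by rewrite -subr_ge0; have [D0 _ _] := DeltaV_class n; exact: D0.
Qed.

(** [V m n] telescopes into the increments up to m, each nondecreasing in n. *)
Lemma V_nondecreasing_n m x : 0 < x -> nondecreasing_seq (fun n => V m n x).
Proof.
move=> x0; apply/nondecreasing_seqP => n; elim: m => [|m IH].
  by rewrite !V0E.
have := DeltaV_nondecreasing n m x0; rewrite /DeltaV -!pred_Sn.
by lra.
Qed.

(** Exercising adds the constant 1 of the payoff to min(m, n+1), which gives min(m+1, n+2); waiting
    keeps min(m+1, n+1), which is no larger. *)
Lemma V_gentle m n : gentle (minn m n.+1)%:R (V m n).
Proof.
elim: n m => [|n IH] [|m].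
1,3: by rewrite V0E min0n => x y _ _; lra.
  by rewrite minnSS minn0 /=; exact: gentle_payoff.
rewrite /= minnSS; apply: gentle_max.
  rewrite -natr1 addrC; apply: gentleD; first exact: gentle_payoff.
  exact: opA_gentle.
apply: opA_gentle => //; apply: gentle_le (IH m.+1).
by rewrite ler_nat; lia.
Qed.

(** The defining recursion is used instead of the increments, because the min in [DeltaVSE] need not
    preserve convexity. *)
Lemma V_convex m n : convex_pos (V m n).
Proof.
elim: n m => [|n IH] [|m].
1,3: by rewrite V0E => t x y _ _ _; rewrite !mulr0 addr0.
  exact: convex_pos_payoff.
rewrite /=; apply: convex_pos_max; last exact: opA_convex.
by apply: convex_posD; [exact: convex_pos_payoff|exact: opA_convex].
Qed.

End SwingOption.

Unset Implicit Arguments.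

Theorem proposition3p5 (R : realType) (r lam K : R)
    (hr : 0 <= r) (hlam : 1 < lam)
    (hlow : lam^-1 < 1 + r) (hup : 1 + r < lam) (hK : 0 < K)
    (n m : nat) (hm : (1 <= m)%N) :
  [/\ (* (i) *)
      classM (DeltaV r lam K m n) /\ classM (f r lam K m n),
      (* (ii) *)
      forall x : R, 0 < x ->
        DeltaV r lam K m.+1 n x <= DeltaV r lam K m n x /\
        f r lam K m.+1 n x <= f r lam K m n x,
      (* (iii) *)
      forall x : R, 0 < x ->
        DeltaV r lam K m n x <= DeltaV r lam K m n.+1 x /\
        f r lam K m n x <= f r lam K m n.+1 x
    & (* (iv) *)
      [/\ convex_function (`]0, +oo[%classic : set R) (V r lam K m n),
          {in `]0, +oo[ &, nonincreasing_fun (V r lam K m n)},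
          (minn m n.+1)%:R.-lipschitz_(`]0, +oo[%classic) (V r lam K m n),
          forall (x : R) (n' : nat), 0 < x -> (n <= n')%N ->
            V r lam K m n x <= V r lam K m n' x
        & forall (x : R) (m' : nat), 0 < x -> (m <= m')%N ->
            V r lam K m n x <= V r lam K m' n x]].
Proof.
case: m hm => // m _.
have [D0 Dg Dm] := DeltaV_class (K := K) hr hlam hlow hup n.
have [f0 fg fm] := f_class (K := K) hr hlam hlow hup n.
split.
- by split; apply: gentle_classM; [exact: D0|exact: Dg|exact: f0|exact: fg].
- by move=> x x0; split; [exact: Dm|exact: fm].
- by move=> x x0; split; [exact: DeltaV_nondecreasing|exact: f_nondecreasing].
- have Vg := V_gentle (K := K) hr hlam hlow hup m.+1 n.
  split.
  + exact/convex_pos_convex_function/V_convex.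
  + exact: gentle_nonincreasing Vg.
  + move=> [x y] [/=]; rewrite !in_itv/= !andbT => x0 y0.
    exact: gentle_lipschitz.
  + by move=> x n' x0; exact: V_nondecreasing_n.
  + by move=> x m' x0; exact: V_nondecreasing_m.
Qed.
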